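(* Let $G$ be a finite group such that every composition factor of $G$ is a cyclic group, or is isomorphic to an alternating group $A_n$ for some $n$, or is isomorphic to a projective special linear group $PSL_n(q)$ for some $n\ge 2$ and some prime power $q$. Then $G$ has an Ordered Generating System.
   Context: Definition. A sequence of elements $a_1,\ldots,a_n$ of a group $G$ is an Ordered Generating System of $G$ if there exist non-negative integers $m_1,\ldots,m_n$ such that every element $g\in G$ has a unique representation of the form $g=a_1^{i_1}a_2^{i_2}\cdots a_n^{i_n}$ with integers $0\le i_k\le m_k$ for every $1\le k\le n$ (i.e. the exponent tuple $(i_1,\ldots,i_n)$ in this range exists and is unique). A group is said to have an Ordered Generating System if such a finite sequence exists; the empty sequence is an Ordered Generating System of the trivial group. $PSL_n(q)$ denotes the projective special linear group of degree $n$ over the field with $q$ elements. *)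

(* Defs.v *)
From HB Require Import structures.
From mathcomp Require Import all_boot all_order all_fingroup all_algebra all_solvable.

Set Implicit Arguments.
Unset Strict Implicit.
Unset Printing Implicit Defensive.

Import GroupScope.

(* The product is taken in increasing order of the index; n = 0 is allowed. *)
Definition ordered_generating_system (gT : finGroupType) (G : {set gT})
    (n : nat) (a : n.-tuple gT) : Prop :=
  (forall k : 'I_n, tnth a k \in G) /\
  exists m : {ffun 'I_n -> nat}, forall g : gT, g \in G ->
    exists! i : {ffun 'I_n -> nat},
      (forall k : 'I_n, i k <= m k) /\ g = \prod_(k < n) tnth a k ^+ i k.

Definition has_ordered_generating_system (gT : finGroupType) (G : {set gT}) :=
  exists (n : nat) (a : n.-tuple gT), ordered_generating_system G a.

(* [comps G s] leaves G out of s, so [pairmap] lists the quotients of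
   consecutive terms of the whole series G :: s. *)
Definition composition_factor (gT : finGroupType) (G : {group gT})
    (K : section gT) : Prop :=
  exists2 s : seq {group gT}, comps G s & K \in pairmap (@mkSec gT) G s.

(* [{'GL_n[F]}] consists of matrices of size [n.-1.+1], so the degree is n
   only for n > 0. *)
Definition SL (n : nat) (F : finFieldType) : {set {'GL_n[F]}} :=
  [set u : {'GL_n[F]} | (\det (GLval u) == 1)%R].

Lemma SL_group_set (n : nat) (F : finFieldType) : group_set (SL n F).
Proof.
apply/group_setP; split=> [|u v]; first by rewrite inE GL_1E det1.
by rewrite !inE GL_MxE det_mulmx => /eqP-> /eqP->; rewrite GRing.mulr1.
Qed.

Canonical SL_group (n : nat) (F : finFieldType) := Group (SL_group_set n F).

Definition PSL (n : nat) (F : finFieldType) := SL n F / 'Z(SL n F).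

(* Main.v *)
Require Import Defs.
From HB Require Import structures.
From mathcomp Require Import all_boot all_order all_fingroup all_algebra all_solvable all_field.

Set Implicit Arguments.
Unset Strict Implicit.
Unset Printing Implicit Defensive.

Import GroupScope.

(* Call {1, a, ..., a^m} a progression. Factorisations G = H A_1 ... A_k with
   unique factors, H a subgroup and the A_i progressions, compose along
   H <= G <= G' and lift along quotients, so it suffices to treat A_n and
   PSL_n(q), and there, by induction on n, the action on the n points, resp. on
   the N = (q^n - 1)/(q - 1) lines of F_q^n.  In the group S_n, resp.
   GL_n(q), some g permutes these N points in a single cycle (an n-cycle, resp. a
   Singer cycle), and g^e lies in the small group for e = 2, resp. e = q - 1.
   With d = gcd(e, N), every residue modulo N is i + e j for unique i < d and
   j < N/d, so if b in the small group agrees with g along the first d points of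
   the cycle, the products b^i (g^e)^j represent the cosets of a point
   stabiliser.  As d <= 2, resp. d | n, such a b is obtained by correcting g away
   from these points.  The stabiliser of a line in SL_n(q) maps onto
   GL_(n-1)(q) with abelian kernel, which closes the induction. *)

(** * Progressions, and factorisations relative to a subgroup *)

Definition progression (gT : finGroupType) (am : gT * nat) : {set gT} :=
  [set am.1 ^+ i | i : 'I_am.2.+1].

(* The cardinality bound forces every element of [G] to have a unique
   factorisation. *)
Definition ogs_over (gT : finGroupType) (H G : {set gT}) : Prop :=
  exists s : seq (gT * nat),
    [/\ {in s, forall x, x.1 \in G},
        G \subset H * \prod_(x <- s) progression x
      & ((\prod_(x <- s) x.2.+1) * #|H| <= #|G|)%N ].

Section RelativeSystems.

Variable gT : finGroupType.
Implicit Types (G H K W : {group gT}) (s : seq (gT * nat)).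

Lemma progressionP (a : gT) m x :
  reflect (exists2 i, i <= m & x = a ^+ i) (x \in progression (a, m)).
Proof.
apply: (iffP imsetP) => [[i _ ->] | [i ltim ->]].
  by exists i; rewrite // -ltnS.
by rewrite -ltnS in ltim; exists (Ordinal ltim).
Qed.

Lemma progression_sub G x : x.1 \in G -> progression x \subset G.
Proof.
by case: x => a m /= Ga; apply/subsetP=> _ /progressionP[i _ ->]; apply: groupX.
Qed.

Lemma prod_progression_sub G s :
  {in s, forall x, x.1 \in G} -> \prod_(x <- s) progression x \subset G.
Proof.
elim: s => [|x s IHs] Gs; first by rewrite big_nil sub1G.
rewrite big_cons mul_subG ?progression_sub ?Gs ?mem_head ?IHs // => y sy.
by rewrite Gs // inE sy orbT.
Qed.

(** Concatenate the two sequences: the factors of [H] over [K] come first, and the two cardinality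
    bounds multiply. *)
Lemma ogs_over_trans (K H G : {set gT}) :
  H \subset G -> ogs_over K H -> ogs_over H G -> ogs_over K G.
Proof.
move=> sHG [s1 [H1 sub1 card1]] [s2 [H2 sub2 card2]]; exists (s1 ++ s2); split.
- move=> x; rewrite mem_cat => /orP[/H1 /(subsetP sHG) // | /H2 //].
- rewrite big_cat /= mulgA; apply: subset_trans sub2 _; exact: mulSg.
- rewrite big_cat /= mulnAC mulnC.
  by apply: leq_trans card2; rewrite leq_mul2l card1 orbT.
Qed.

Lemma cyclic_ogs_over G : cyclic G -> ogs_over 1 G.
Proof.
case/cyclicP=> x ->; exists [:: (x, #[x].-1)]; split=> [y||].
- by rewrite inE => /eqP->; rewrite cycle_id.
- rewrite big_seq1 mul1g; apply/subsetP=> _ /cyclePmin[i lti ->].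
  by apply/progressionP; exists i; rewrite // -ltnS prednK ?order_gt0.
- by rewrite big_seq1 /= prednK ?order_gt0 // cards1 muln1.
Qed.


(** Right coset representatives of [W :&: G] in [G] also represent the cosets of [W] in [W * G], and
    the two indices agree by the second isomorphism theorem. *)
Lemma ogs_over_mul W G :
  G \subset 'N(W) -> ogs_over (W :&: G) G -> ogs_over W (W * G).
Proof.
move=> nWG [s [sG sub card]]; exists s; split.
- by move=> x /sG; apply/subsetP/mulG_subr.
- apply: subset_trans (mulgS W sub) _; rewrite mulgA mulSg //.
  by rewrite -{3}(mulGid W) mulgS ?subsetIl.
- rewrite -(leq_pmul2r (cardG_gt0 (W :&: G)%G)) /= -mul_cardG mulnAC mulnC.
  by rewrite leq_mul2l card orbT.
Qed.

End RelativeSystems.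

(** * Transport of factorisations along morphisms *)

Section Morphism.

Variables (aT rT : finGroupType) (D : {group aT}) (f : {morphism D >-> rT}).
Implicit Types G H : {group aT}.

Lemma morphim_progression x :
  x.1 \in D -> f @* progression x = progression (f x.1, x.2).
Proof.
case: x => a m /= Da; apply/setP=> y; apply/morphimP/progressionP.
  by case=> _ _ /progressionP[i lti ->] ->; exists i; rewrite // morphX.
case=> i lti ->; exists (a ^+ i); rewrite ?groupX ?morphX //.
by apply/progressionP; exists i.
Qed.

Lemma morphim_prod_progression s : {in s, forall x, x.1 \in D} ->
  f @* (\prod_(x <- s) progression x)
    = \prod_(x <- [seq (f x.1, x.2) | x <- s]) progression x.
Proof.
elim: s => [|x s IHs] Ds; first by rewrite !big_nil morphim1.
rewrite /= !big_cons morphimMl ?progression_sub ?morphim_progression ?Ds ?mem_head //.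
by rewrite IHs // => y sy; rewrite Ds // inE sy orbT.
Qed.

Lemma card_morphim_ker G : G \subset D -> (#|f @* G| * #|'ker_G f| = #|G|)%N.
Proof. by move=> sGD; rewrite card_morphim (setIidPr sGD) mulnC LagrangeI. Qed.

(** As the kernel in [G] lies in [H], the index of [H] in [G] is preserved by [f]. Progressions map
    to progressions of the same length; conversely, choose preimages of their generators in [G]. *)
Lemma ogs_over_morphim G H :
    H \subset G -> G \subset D -> 'ker_G f \subset H ->
  ogs_over H G <-> ogs_over (f @* H) (f @* G).
Proof.
move=> sHG sGD skH; have sHD := subset_trans sHG sGD.
have kerE : 'ker_H f = 'ker_G f.
  by apply/eqP; rewrite eqEsubset setSI //= subsetI skH subsetIr.
have cardE (m : nat) : (m * #|H| <= #|G|) = (m * #|f @* H| <= #|f @* G|).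
  rewrite -(card_morphim_ker sGD) -(card_morphim_ker sHD) kerE mulnA.
  by rewrite leq_pmul2r ?cardG_gt0.
split=> [[s [sG sub card]] | [s [sG sub card]]].
  have sD : {in s, forall x, x.1 \in D} by move=> x /sG /(subsetP sGD).
  exists [seq (f x.1, x.2) | x <- s]; split.
  - by move=> _ /mapP[x sx ->]; rewrite mem_morphim ?sD ?sG.
  - by rewrite -morphim_prod_progression // -morphimMl // morphimS.
  - by rewrite big_map /= -cardE.
(* A section of [f] with values in [G]; the default 1 is taken only outside [f @* G]. *)
pose h y := odflt 1 [pick x in G | f x == y].
have hP y : y \in f @* G -> h y \in G /\ f (h y) = y.
  case/morphimP=> x _ Gx ->; rewrite /h; case: pickP => [z /andP[? /eqP] //|].
  by move/(_ x); rewrite Gx eqxx.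
pose t := [seq (h x.1, x.2) | x <- s].
have tG : {in t, forall x, x.1 \in G}.
  by move=> _ /mapP[x sx ->]; case: (hP x.1) => //; apply: sG.
have tD : {in t, forall x, x.1 \in D} by move=> x /tG /(subsetP sGD).
have tE : [seq (f x.1, x.2) | x <- t] = s.
  by rewrite -map_comp map_id_in // => -[a m] /sG /= /hP[_ ->].
exists t; split=> //; last by rewrite big_map cardE.
rewrite -tE -morphim_prod_progression // -morphimMl // in sub.
apply/subsetP=> g Gg.
have/(subsetP sub)/morphimP[u Du Hu fgu] : f g \in f @* G.
  by rewrite mem_morphim ?(subsetP sGD).
have Gu : u \in G.
  move: u Hu {Du fgu}; apply/subsetP.
  by rewrite -(mulGid G) mulgSS ?prod_progression_sub.
(* Here [g] and [u] have the same image, so they differ on the left by an element of the kernel,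
   which the factor [H] absorbs. *)
suff: g * u^-1 \in H.
  by move=> Hgu; rewrite -[g](mulgKV u) -(mulGid H) -[H * H * _]mulgA mem_mulg.
apply: (subsetP skH); rewrite inE groupM ?groupV //=.
have Dg := subsetP sGD _ Gg.
by apply/kerP; rewrite ?groupM ?groupV // morphM ?groupV // morphV // fgu mulgV.
Qed.

End Morphism.

Lemma ogs_over_isog (aT rT : finGroupType) (G : {group aT}) (K : {group rT}) :
  G \isog K -> ogs_over 1 K -> ogs_over 1 G.
Proof.
case/isogP=> f injf <-; rewrite -(morphim1 f).
by apply: (ogs_over_morphim (sub1G G) (subxx G) _).2; rewrite subIset ?injf ?orbT.
Qed.

(** * Quotients and solvable groups *)

Section Extension.

Variable gT : finGroupType.
Implicit Types (G H K N W : {group gT}).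

Lemma ogs_over_quotient N G : N <| G -> ogs_over N G <-> ogs_over 1 (G / N).
Proof.
case/andP=> sNG nNG; rewrite -(trivg_quotient N).
by apply: ogs_over_morphim; rewrite // ker_coset subsetIr.
Qed.

(** Induction on the order: a nontrivial solvable group has a normal subgroup of prime index, and
    the quotient by it is cyclic. *)
Lemma solvable_ogs G : solvable G -> ogs_over 1 G.
Proof.
have [n] := ubnP #|G|; elim: n G => // n IHn G /ltnSE leGn solG.
have [-> | ntG] := eqVneq (G : {set gT}) 1.
  exact: (cyclic_ogs_over (cyclic1 gT)).
have [N nsNG prN] := sol_prime_factor_exists solG ntG.
have [sNG nNG] := andP nsNG.
apply: (ogs_over_trans sNG).
  apply: IHn (solvableS sNG solG); apply: leq_trans leGn.
  rewrite proper_card // properEneq sNG andbT.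
  by apply: contraTneq prN => ->; rewrite indexgg.
apply: (ogs_over_quotient nsNG).2 (cyclic_ogs_over (prime_cyclic _)).
by rewrite card_quotient.
Qed.

End Extension.

(** * Cosets permuted in a single cycle *)

Section CyclicCover.

Variable gT : finGroupType.
Implicit Types (G H N : {group gT}).

Lemma solvable_ogs_over N G : N <| G -> solvable (G / N) -> ogs_over N G.
Proof.
by move=> nsNG solGN; apply: (ogs_over_quotient nsNG).2; apply: solvable_ogs.
Qed.

Lemma abelian_ogs_over N G : N <| G -> abelian (G / N) -> ogs_over N G.
Proof. by move=> nsNG /abelian_sol; apply: solvable_ogs_over. Qed.

(** The element [g] may lie outside [G]. The cosets [H g^k] depend only on [k] modulo [N] and cover
    [G]. Since [b^i g^-i] is in [H], the element [b^i (g^e)^j] of [G] lies in [H g^(i + e j)], and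
    with [d = gcd(e, N)] the exponents [i + e j] for [i < d], [j < N/d] run once through the
    residues modulo [N]. *)
Lemma ogs_over_cyclic_cover G H (g b : gT) (e N : nat) :
    0 < e -> 0 < N -> (forall k, (g ^+ k \in H) = (N %| k)) ->
    G \subset H * <[g]> -> g ^+ e \in G -> b \in G ->
    (forall i, i < gcdn e N -> b ^+ i * g ^- i \in H) ->
  ogs_over (G :&: H) G.
Proof.
move=> e0 N0 gH covG Ge Gb bg; set d := gcdn e N in bg.
have d0 : 0 < d by rewrite gcdn_gt0 e0.
have dN : N = (d * (N %/ d))%N by rewrite mulnC divnK ?dvdn_gcdr.
have Nd0 : 0 < N %/ d by rewrite divn_gt0 // dvdn_leq ?dvdn_gcdr.
have gH_mod k l : k = l %[mod N] -> g ^+ k * g ^- l \in H.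
  wlog lekl : k l / l <= k => [th | /eqP].
    case/orP: (leq_total l k) => [/th // | lekl eqkl].
    by rewrite -groupV invMg invgK th.
  by rewrite eqn_mod_dvd // -gH -{2}(subnK lekl) expgD mulgK.
have repr_g k : exists i j, [/\ i < d, j < N %/ d
                             & g ^+ k * (b ^+ i * (g ^+ e) ^+ j)^-1 \in H].
  (* Bezout gives [u e = d] modulo [N]. Hence [k = k %% d + d (k %/ d)] is congruent to [i + e j]
     with [j = u (k %/ d)], and [j] may be reduced modulo [N/d] because [d] divides [e]. *)
  case: (egcdnP N e0) => u v uv _; rewrite -/d in uv.
  exists (k %% d), ((u * (k %/ d)) %% (N %/ d)); rewrite !ltn_pmod //; split=> //.
  set i := k %% d; set j := _ %% _.
  have jE : i + e * j = k %[mod N].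
    rewrite (divn_eq k d) addnC -/i; apply/eqP; rewrite eqn_modDr; apply/eqP.
    have -> : e * j = (e * u * (k %/ d)) %[mod N].
      have /dvdnP[c eE] : d %| e by rewrite dvdn_gcdl.
      by rewrite eE -!mulnA /j muln_modr -dN modnMmr.
    by rewrite (mulnC e) uv mulnDl mulnAC modnMDl mulnC.
  have -> : g ^+ k * (b ^+ i * (g ^+ e) ^+ j)^-1
     = (g ^+ k * g ^- (i + e * j)) * (b ^+ i * g ^- i)^-1.
    by rewrite expgD -expgM !invMg invgK !mulgA mulgKV.
  by rewrite groupM ?groupV ?bg ?ltn_pmod // gH_mod.
exists [:: (b, d.-1); (g ^+ e, (N %/ d).-1)]; split.
- by move=> x; rewrite !inE => /orP[] /eqP->.
- apply/subsetP=> x Gx.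
  have /mulsgP[h _ Hh /cycleP[k ->] xE] := subsetP covG x Gx.
  have [i [j [ltid ltjN Hgk]]] := repr_g k.
  set y := b ^+ i * (g ^+ e) ^+ j in Hgk.
  have Gy : y \in G by apply: groupM; apply: groupX.
  rewrite -(mulgKV y x); apply: mem_mulg.
    by rewrite inE groupM ?groupV //= xE -mulgA groupM.
  rewrite big_cons big_seq1; apply: mem_mulg; apply/progressionP.
    by exists i; rewrite // -ltnS prednK.
  by exists j; rewrite // -ltnS prednK.
(* The two lengths multiply to [N]. It remains to see that the index of [G :&: H] in [G] is at least
   [N]: the cosets [H g^k] for [k < N] are distinct, and each contains an element of [G]. *)
- rewrite big_cons big_seq1 /= !prednK // -dN mulnC -(LagrangeI G H) leq_mul2l.
  rewrite -[N]card_ord; apply/orP; right.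
  have injf : injective (fun k : 'I_N => H :* g ^+ k).
    move=> k l /rcoset_eqP; rewrite mem_rcoset => Hkl; apply: val_inj.
    wlog lelk : k l Hkl / l <= k => [th|].
      case/orP: (leq_total l k) => [/(th k l Hkl) // | lelk].
      by apply/esym/th => //; rewrite -groupV invMg invgK.
    move: Hkl; rewrite -{1}(subnK lelk) expgD mulgK gH => dvdN.
    apply/eqP; rewrite eqn_leq lelk -subn_eq0 andbT.
    move: dvdN; apply: contraTT; rewrite -lt0n => pos.
    by rewrite gtnNdvd //; apply: leq_ltn_trans (leq_subr _ _) (ltn_ord k).
  rewrite -(card_imset _ injf); apply/subset_leq_card/subsetP=> _ /imsetP[k _ ->].
  have [i [j [_ _ Hgk]]] := repr_g k.
  rewrite (rcoset_eqP (_ : _ \in H :* (b ^+ i * (g ^+ e) ^+ j))) ?mem_rcoset //.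
  rewrite mem_rcosets; apply: (subsetP (mulG_subr H G)).
  by apply: groupM; apply: groupX.
Qed.

End CyclicCover.

(** * From factorisations to ordered generating systems, and along composition series *)

(** Evaluation maps the bounded exponent tuples onto [G]. There are at most [#|G|] such tuples, so
    this surjection is injective, which is the required uniqueness. *)
Lemma ogs_over_has_ogs (gT : finGroupType) (G : {group gT}) :
  ogs_over 1 G -> has_ordered_generating_system G.
Proof.
move=> [s [sG cov card]]; rewrite mul1g big_tnth in cov.
rewrite cards1 muln1 big_tnth in card; set t := tnth (in_tuple s) in cov card.
pose E := {dffun forall k : 'I_(size s), 'I_(t k).2.+1}.
pose ev (c : E) := \prod_k (t k).1 ^+ c k.
have tG k : (t k).1 \in G by apply: sG; apply: mem_tnth.
have covE : G \subset ev @: E.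
  apply/subsetP=> g /(subsetP cov) /prodsgP[/= h hP ->].
  have hP' k : exists c : 'I_(t k).2.+1, h k == (t k).1 ^+ c.
    by have /imsetP[c _ ->] := hP k isT; exists c.
  pose c : E := [ffun k => xchoose (hP' k)].
  apply/imsetP; exists c => //; apply: eq_bigr => k _; rewrite ffunE.
  exact/eqP/(xchooseP (hP' k)).
have card_exp : #|E| = (\prod_k (t k).2.+1)%N.
  rewrite card_dep_ffun foldrE big_map big_enum /=.
  by apply: eq_bigr => k _; rewrite card_ord.
have inj_ev : {in E &, injective ev}.
  apply/imset_injP; rewrite eqn_leq leq_imset_card card_exp (leq_trans card) //.
  exact: subset_leq_card.
exists (size s), (map_tuple fst (in_tuple s)); split=> [k|].
  by rewrite tnth_map; apply: tG.
exists [ffun k => (t k).2] => g Gg.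
have /imsetP[c _ gE] := subsetP covE g Gg.
exists [ffun k => val (c k)]; split=> [|i [lei gi]].
  split=> [k|]; first by rewrite !ffunE -ltnS; apply: ltn_ord.
  by rewrite gE; apply: eq_bigr => k _; rewrite tnth_map ffunE.
(* A competing exponent function obeys the same bounds, so [inord] turns it into an element of [E]
   without changing its values. *)
pose c' : E := [ffun k => inord (i k)].
have c'E k : c' k = i k :> nat.
  by rewrite ffunE inordK // ltnS; move: (lei k); rewrite ffunE.
apply/ffunP=> k; rewrite ffunE -c'E; suff -> : c = c' by [].
apply: inj_ev => //; rewrite -gE gi; apply: eq_bigr => l _.
by rewrite tnth_map c'E.
Qed.

Lemma comps_ogs_over (gT : finGroupType) (G : {group gT}) (s : seq {group gT}) :
    comps G s ->
    {in pairmap (@mkSec gT) G s, forall K : section gT, ogs_over 1 K} ->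
  ogs_over 1 G.
Proof.
elim: s G => [|H s IHs] G.
  by case/compsP=> /= -> _ _; apply: cyclic_ogs_over (cyclic1 gT).
move=> compG facG; have compH := comps_cons compG.
case/compsP: compG => _ /= /andP[/maxnormal_normal nsHG _].
apply: ogs_over_trans (normal_sub nsHG) _ _.
  by apply: IHs compH _ => K sK; apply: facG; rewrite inE sK orbT.
apply: (ogs_over_quotient nsHG).2.
exact: (facG (mkSec G H) (mem_head _ _)).
Qed.

(** * Alternating groups *)

Section Alt.

Variable T : finType.

(** The cyclic successor on ['I_#|T|], transported to [T] by [enum_rank], is a single cycle through
    all points. *)
Lemma exists_cycle_perm (x : T) :
  exists g : {perm T}, (forall k, ((g ^+ k) x == x) = (#|T| %| k)) /\
    forall y, exists k, y = (g ^+ k) x.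
Proof.
have injf : injective (fun y : T => enum_val (ordS (enum_rank y))).
  by move=> y z /enum_val_inj /ordS_inj /enum_rank_inj.
exists (perm injf).
have gE k : enum_rank ((perm injf ^+ k) x) = (enum_rank x + k) %% #|T| :> nat.
  elim: k => [|k IHk]; first by rewrite expg0 perm1 addn0 modn_small.
  rewrite expgSr permM permE enum_valK /= IHk.
  by rewrite -[(_ %% _).+1]addn1 modnDml -addnA addn1.
split=> [k | y].
  rewrite -(inj_eq enum_rank_inj) -val_eqE /= gE.
  rewrite -[X in _ == X](modn_small (ltn_ord (enum_rank x))).
  by rewrite -[X in _ == X %% _]addn0 eqn_modDl mod0n.
(* The difference of the two ranks modulo [#|T|], kept non-negative. *)
exists (enum_rank y + (#|T| - enum_rank x)); apply: enum_rank_inj; apply: val_inj.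
by rewrite /= gE addnCA subnKC ?modnDr ?modn_small // ltnW.
Qed.

(** The cyclic cover applies with [e = 2], since [g ^+ 2] is even. As [gcd(2, #|T|)] is at most 2,
    only the exponents 0 and 1 of [b] matter, so it is enough that [b] and [g] agree at [x]. *)
Lemma Alt_ogs_over_astab (x : T) :
  2 < #|T| -> ogs_over 'C_('Alt_T)[x | 'P] 'Alt_T.
Proof.
move=> T3; have [g [gx trg]] := exists_cycle_perm x.
have [b Altb bx] : exists2 b : {perm T}, b \in 'Alt_T & b x = g x.
  have [oddg | eveng] := boolP (odd_perm g); last by exists g; rewrite ?Alt_even.
  have : 1 < #|[set~ g x]| by rewrite cardsC1 -ltnS prednK // (leq_trans _ T3).
  case/card_gt1P=> y [z]; rewrite !inE => -[ygx zgx yz].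
  (* A transposition of two points other than [g x] corrects the parity of [g] and keeps the image
     of [x]. *)
  exists (g * tperm y z); first by rewrite Alt_even odd_permM odd_tperm yz oddg.
  by rewrite permM tpermD.
pose H := 'C[x | 'P]%G.
have HP (u : {perm T}) : (u \in H) = (u x == x).
  by rewrite !inE /= sub1set inE.
apply: (@ogs_over_cyclic_cover _ 'Alt_T H g b 2 #|T|) => //.
- by apply: leq_trans T3.
- by move=> k; rewrite HP gx.
- apply/subsetP=> u _; have [k uk] := trg (u x).
  rewrite -(mulgKV (g ^+ k) u) mem_mulg ?groupV ?mem_cycle // HP permM uk.
  by rewrite -permM mulgV perm1.
- by rewrite Alt_even expgS expg1 odd_permM addbb.
- case=> [|[|i]].
  + by rewrite expg0 mul1g invg1 group1.
  + by rewrite HP permM bx -permM mulgV perm1.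
  + by rewrite leqNgt (leq_ltn_trans (dvdn_leq _ (dvdn_gcdl _ _))).
Qed.

End Alt.

(** Induction on [#|T|]: the stabiliser of [x] is the alternating group on the remaining points. *)
Lemma Alt_ogs (T : finType) : ogs_over 1 'Alt_T.
Proof.
have [n] := ubnP #|T|; elim: n T => // n IHn T /ltnSE leTn.
have [T2 | T3] := leqP #|T| 2.
  suff /card_le1_trivg-> : #|'Alt_T| <= 1 by apply: cyclic_ogs_over (cyclic1 _).
  have [T1 | T1] := leqP #|T| 1.
    rewrite (leq_trans (subset_leq_card (Alt_subset T))) // card_Sym.
    by case: #|T| T1 => [|[]].
  have /eqP T2' : #|T| == 2 by rewrite eqn_leq T2.
  by rewrite -(leq_pmul2l (isT : 0 < 2)) card_Alt ?T2'.
have x : T by have /card_gt0P/sigW[x] : 0 < #|T| by apply: leq_trans T3.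
apply: ogs_over_trans (Alt_ogs_over_astab x T3); first exact: subsetIl.
apply: ogs_over_isog (rfd_iso x) (IHn _ _).
by rewrite card_sig cardC1 -ltnS prednK // (leq_trans _ T3).
Qed.

(** * Extensions of finite fields *)

Section FiniteFieldExtension.

Import GRing.Theory.
Local Open Scope ring_scope.

(** Take for [L] the splitting field of [X^m - X] over [F]. This polynomial has [m] distinct roots,
    and they exhaust [L]: they are the fixed points of the [n]-th power of the Frobenius map, and
    they generate [L]. *)
Lemma exists_finField_ext (F : finFieldType) (n : nat) : (0 < n)%N ->
  exists (L : finFieldType) (_ : {rmorphism F -> L}), #|L| = (#|F| ^ n)%N.
Proof.
move=> n0; set m := (#|F| ^ n)%N.
have m1 : (1 < m)%N by rewrite -(exp1n n) ltn_exp2r // finNzRing_gt1.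
pose q (R : nzRingType) : {poly R} := 'X^m - 'X.
have szq (R : nzRingType) : size (q R) = m.+1.
  by rewrite size_polyDl size_polyXn // size_polyN size_polyX.
have /FinSplittingFieldFor[/= L] : q F != 0 by rewrite -size_poly_eq0 szq.
rewrite [map_poly _ _]rmorphB /= map_polyXn map_polyX -/(q L) => -[zs Dq defL].
(* [m] is a positive power of the characteristic, so the derivative of [X^m - X] is -1 and its roots
   are simple. *)
have m0 : m%:R = 0 :> L.
  have [p _ pF] := finPcharP F; have pL : p \in [pchar L] by rewrite pchar_lalg.
  move: m1; rewrite /m (card_pprimeChar pF) -expnM; case: (_ * n)%N => // e _.
  by rewrite natrX (pcharf0 pL) expr0n.
have Uzs : uniq zs.
  rewrite -separable_prod_XsubC -(eqp_separable Dq) separable_poly.unlock.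
  rewrite derivB derivXn derivX -mulr_natr -polyC_natr m0 mulr0 sub0r.
  by rewrite -scaleN1r coprimepZr ?oppr_eq0 ?oner_eq0 // coprimep1.
have szs : size zs = m.
  by apply: succn_inj; rewrite -(szq L) (eqp_size Dq) size_prod_XsubC.
have [a _ Da] := finField_galois_generator (sub1v {:L}%AS).
have aE k x : (a ^+ k)%g x = x ^+ (#|F| ^ k).
  elim: k x => [|k IHk] x; first by rewrite gal_id expr1.
  by rewrite expgSr galM ?memvf // IHk Da ?memvf // dimv1 expn1 -exprM expnSr.
have zsE x : (x \in zs) = (x ^+ m == x).
  by rewrite -root_prod_XsubC -(eqp_root Dq) /root !hornerE subr_eq0.
have fixL : ({:L} <= fixedSpace (a ^+ n)%g)%VS.
  rewrite -defL; apply/Fadjoin_seqP; split=> [|z]; first exact: sub1v.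
  by rewrite zsE => /eqP zm; apply/fixedSpaceP; rewrite aE.
pose Fm := FinFieldExtType L; exists Fm, (in_alg L).
have /eq_card-> : Fm =i zs.
  move=> x; rewrite zsE -aE; apply/esym/eqP/fixedSpaceP/(subvP fixL)/memvf.
by rewrite (card_uniqP _).
Qed.
(** Over [F], [X^q - X] is the product of all [X - c]; apply [f] and evaluate at [y]. *)
Lemma Frobenius_fixed_in_image (F L : finFieldType) (f : {rmorphism F -> L})
    (y : L) :
  y ^+ #|F| = y -> exists c, y = f c.
Proof.
move=> yq; have := finField_genPoly F => /(congr1 (fun p => (map_poly f p).[y])).
rewrite rmorphB /= map_polyXn map_polyX !hornerE yq subrr rmorph_prod horner_prod.
move/esym/eqP/prodf_eq0=> [c _].
rewrite rmorphB /= map_polyX map_polyC !hornerE subr_eq0.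
by move/eqP->; exists c.
Qed.

Lemma unitmx_GL (R : finComUnitRingType) n (A : 'M[R]_n.+1) :
  A \in unitmx -> exists g : {'GL_n.+1[R]}, GLval g = A.
Proof. by move=> uA; exists (FinRing.Unit (uA : A \is a GRing.unit)). Qed.

Lemma exists_primitive_element (L : finFieldType) :
  exists z : L, (forall y, y != 0 -> exists k, y = z ^+ k)
    /\ forall k, (z ^+ k == 1) = (#|L|.-1 %| k)%N.
Proof.
have /cyclicP[u uE] := field_unit_group_cyclic [set: {unit L}].
exists (val u); split=> [y y0 | k].
  have yU : y \is a GRing.unit by rewrite unitfE.
  have /cycleP[k yk] : FinRing.Unit yU \in <[u]>%g by rewrite -uE inE.
  by exists k; rewrite -FinRing.val_unitX -yk.
rewrite -FinRing.val_unitX -card_finField_unit uE -orderE order_dvdn.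
exact/(inj_eq val_inj (u ^+ k)%g 1%g).
Qed.

(** * Coordinates in powers of a primitive element, and the Singer cycle *)

Section Singer.

Variables (F L : finFieldType) (f : {rmorphism F -> L}) (z : L).
Hypothesis z_gen : forall y, y != 0 -> exists k, y = z ^+ k.

(** The vector is read as the coefficients of a polynomial of degree less than [d], evaluated at
    [z]; so it becomes a combination of [1, z, ..., z^(d-1)]. *)
Definition row_eval d (v : 'rV[F]_d) : L := (map_poly f (rVpoly v)).[z].

Lemma row_eval_is_semilinear d c (u v : 'rV[F]_d) :
  row_eval (c *: u + v) = f c * row_eval u + row_eval v.
Proof.
by rewrite /row_eval linearP /= rmorphD /= map_polyZ hornerD hornerZ.
Qed.

Lemma row_eval0 d : row_eval (0 : 'rV[F]_d) = 0.
Proof. by rewrite /row_eval linear0 rmorph0 horner0. Qed.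

Lemma row_eval_delta d (i : 'I_d) : row_eval (delta_mx ord0 i) = z ^+ i.
Proof. by rewrite /row_eval rVpoly_delta map_polyXn hornerXn. Qed.

Lemma row_eval_comb d n (v : 'rV[F]_n) (w : 'I_n -> 'rV[F]_d) :
  row_eval (\sum_i v 0 i *: w i) = \sum_i f (v 0 i) * row_eval (w i).
Proof.
elim/big_rec2: _ => [|i x y _ IH]; first exact: row_eval0.
by rewrite row_eval_is_semilinear IH.
Qed.

(** A nonzero vector in the kernel is a nonzero polynomial [P] of degree at most [n] with root [z].
    Reducing powers of [z] modulo [P] would then write every element of [L] with [n] coefficients,
    so that [L] would have at most [#|F| ^ n] elements. *)
Lemma row_eval_inj n : #|L| = (#|F| ^ n.+1)%N ->
  injective (@row_eval n.+1).
Proof.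
move=> cardL.
suff ker0 (v : 'rV[F]_n.+1) : row_eval v = 0 -> v = 0.
  move=> u v euv; apply/eqP; rewrite -subr_eq0; apply/eqP/ker0.
  by rewrite addrC -scaleN1r row_eval_is_semilinear euv rmorphN1 mulN1r addNr.
move=> v0; apply/eqP; apply: contraT => nz_v.
set P := rVpoly v; have nzP : P != 0.
  by apply: contraNneq nz_v => P0; rewrite -(rVpolyK v) -/P P0 linear0.
have szP : (size P <= n.+1)%N by apply: size_poly.
have surj (y : L) : y \in codom (@row_eval n).
  have [-> | /z_gen[k ->]] := eqVneq y 0; first by rewrite -(row_eval0 n) codom_f.
  have szR : (size ('X^k %% P)%R <= n)%N.
    by rewrite -ltnS; apply: leq_trans szP; rewrite ltn_modp.
  suff -> : z ^+ k = row_eval (poly_rV ('X^k %% P)%R : 'rV_n) by apply: codom_f.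
  rewrite /row_eval poly_rV_K // -hornerXn -(map_polyXn f) {1}(divp_eq 'X^k P).
  by rewrite rmorphD rmorphM /= hornerD hornerM -/(row_eval v) v0 mulr0 add0r.
have : (#|L| <= #|F| ^ n)%N.
  rewrite -[n in (_ ^ n)%N]mul1n -card_mx -(eq_card (_ : codom (@row_eval n) =i L)).
    exact: leq_image_card.
  by move=> y; rewrite surj.
by rewrite cardL leq_exp2l ?ltnn // finNzRing_gt1.
Qed.

End Singer.

(* [g] is multiplication by a primitive element [z] of the extension of degree
   [n.+1], written in the basis of powers of [z]. *)
Lemma exists_singer_cycle (F : finFieldType) (n : nat) :
  exists g : {'GL_n.+1[F]},
    [/\ forall i, (i <= n)%N ->
          delta_mx ord0 ord0 *m GLval (g ^+ i)%g
            = delta_mx ord0 (inord i) :> 'rV_n.+1,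
        forall v : 'rV_n.+1, v != 0 ->
          exists k, v = delta_mx ord0 ord0 *m GLval (g ^+ k)%g
      & forall k,
          (exists c, delta_mx ord0 ord0 *m GLval (g ^+ k)%g
                       = c *: delta_mx ord0 ord0 :> 'rV_n.+1)
          <-> (\sum_(i < n.+1) #|F| ^ i %| k)%N].
Proof.
have [L [f cardL]] := exists_finField_ext F (ltn0Sn n).
have [z [z_gen z_ord]] := exists_primitive_element L.
pose th : 'rV[F]_n.+1 -> L := @row_eval _ _ f z n.+1.
have th_inj : injective th := row_eval_inj z_gen cardL.
have [th' th'K thK] : bijective th.
  by apply: inj_card_bij th_inj _; rewrite card_mx mul1n cardL.
(* Row [i] holds the coordinates of [z * z^i], so [A] is multiplication by [z]. *)
pose A := \matrix_(i < n.+1) th' (z ^+ i.+1).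
have thA v : th (v *m A) = z * th v.
  rewrite mulmx_sum_row [v in RHS]row_sum_delta /th !row_eval_comb mulr_sumr.
  apply: eq_bigr => i _; rewrite rowK [row_eval _ _ _]thK row_eval_delta.
  by rewrite exprS mulrCA.
have z0 : z != 0.
  have: z ^+ #|L|.-1 == 1 by rewrite z_ord.
  apply: contraTneq => ->; have := finNzRing_gt1 L.
  by case: #|L| => [|[|m]] // _; rewrite expr0n eq_sym oner_eq0.
have [g gA] : exists g : {'GL_n.+1[F]}, GLval g = A.
  apply: unitmx_GL; rewrite -row_free_unit; apply: inj_row_free => v vA0.
  have /eqP := thA v; rewrite vA0 [th 0]row_eval0 eq_sym mulf_eq0 (negPf z0) /=.
  by rewrite -(row_eval0 f z n.+1) => /eqP/th_inj.
have thg k v : th (v *m GLval (g ^+ k)%g) = z ^+ k * th v.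
  elim: k => [|k IHk]; first by rewrite expg0 GL_1E mulmx1 mul1r.
  by rewrite expgSr GL_MxE mulmxA gA thA IHk exprS mulrA.
have th_delta i : th (delta_mx ord0 i) = z ^+ i := row_eval_delta f z i.
exists g; split=> [i lein | v nz_v | k].
- by apply: th_inj; rewrite thg !th_delta inordK // mulr1.
- have [|k vk] := z_gen (th v).
    by apply: contraNneq nz_v; rewrite -(row_eval0 f z n.+1) => /th_inj->.
  by exists k; apply: th_inj; rewrite thg th_delta mulr1.
have thZ c : th (c *: delta_mx ord0 ord0) = f c.
  rewrite -[_ *: _]addr0 [th _]row_eval_is_semilinear row_eval0 addr0.
  by rewrite [row_eval _ _ _]th_delta mulr1.
have q1 := finNzRing_gt1 F.
have q0 : (0 < #|F|.-1)%N by rewrite -ltnS prednK // ltnW.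
(* The sum is [(#|L| - 1) / (#|F| - 1)], so it divides [k] exactly when the [(#|F| - 1)]-th power of
   [z ^+ k] is 1, that is, when [z ^+ k] comes from [F]. *)
have -> : (\sum_(i < n.+1) #|F| ^ i %| k)%N = ((z ^+ k) ^+ #|F|.-1 == 1).
  by rewrite -exprM z_ord cardL predn_exp mulnC dvdn_pmul2r.
have zk0 : z ^+ k != 0 by rewrite expf_neq0.
have qE : #|F| = #|F|.-1.+1 by rewrite prednK // ltnW.
split=> [[c /(congr1 th)] | /eqP zkq].
  rewrite thg th_delta mulr1 thZ => zkE.
  by apply/eqP/(mulfI zk0); rewrite mulr1 -exprS -qE zkE -rmorphXn expf_card.
have [c zkE] : exists c, z ^+ k = f c.
  by apply: Frobenius_fixed_in_image; rewrite qE exprS zkq mulr1.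
by exists c; apply: th_inj; rewrite thg th_delta mulr1 thZ.
Qed.

End FiniteFieldExtension.

(** * Scalars, transvections and the centre *)

Section LinearGroups.

Import GRing.Theory.

Variable F : finFieldType.

Lemma GLval_inj n : injective (@GLval n F).
Proof. exact: val_inj. Qed.

Lemma det_GLX n (u : {'GL_n.+1[F]}) k :
  (\det (GLval (u ^+ k)%g) = \det (GLval u) ^+ k)%R.
Proof.
elim: k => [|k IHk]; first by rewrite expg0 GL_1E det1.
by rewrite expgS GL_MxE det_mulmx IHk exprS.
Qed.

Lemma scalar_GL_center n (u : {'GL_n.+1[F]}) a :
  GLval u = a%:M%R -> u \in 'Z('GL_n.+1[F]).
Proof.
move=> ua; apply/centerP; split=> [|v _]; first by rewrite inE.
by apply: GLval_inj; rewrite !GL_MxE ua scalar_mxC.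
Qed.

Lemma det_transvection n (i j : 'I_n) :
  i != j -> (\det (1%:M + delta_mx i j : 'M[F]_n) = 1)%R.
Proof.
wlog ltji : i j / j < i => [th ij | ij].
  case: (ltngtP i j) => [ltij | ltji | /val_inj eqij]; last by rewrite eqij eqxx in ij.
    by rewrite -det_tr linearD /= tr_scalar_mx trmx_delta th // eq_sym.
  exact: th.
rewrite det_trig; last first.
  apply/is_trig_mxP=> k l ltkl.
  have kl : k != l by rewrite -val_eqE neq_ltn ltkl.
  rewrite !mxE (negPf kl) add0r.
  case: eqP => //= ki; case: eqP => //= lj.
  by move: ltkl; rewrite ki lj ltnNge ltnW.
rewrite big1 // => k _; rewrite !mxE eqxx; case: (k =P i) => [->|]; last by rewrite addr0.
by rewrite (negPf ij) addr0.
Qed.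

(** Commuting with the transvection [1 + E_ij] means commuting with [E_ij]; comparing column [j]
    makes column [i] vanish off the diagonal and equates the diagonal entries [i] and [j]. *)
Lemma cent_SL_scalar n (u : {'GL_n.+2[F]}) :
  u \in 'C(SL n.+2 F) -> exists a, GLval u = a%:M%R.
Proof.
move=> /centP cu; set A := GLval u.
have uE (k i j : 'I_n.+2) : i != j -> A k i = (A j j *+ (k == i))%R.
  move=> ij; have det_t := det_transvection ij.
  have [t tE] : exists t : {'GL_n.+2[F]}, GLval t = (1%:M + delta_mx i j)%R.
    by apply: unitmx_GL; rewrite unitmxE det_t unitr1.
  have /cu : t \in SL n.+2 F by rewrite inE tE det_t.
  move/(congr1 (@GLval _ _)); rewrite !GL_MxE tE mulmxDr mulmxDl mulmx1 mul1mx => /addrI.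
  rewrite -(mul_delta_mx (0%R : 'I_1)) mulmxA -colE -mulmxA -rowE.
  move/matrixP/(_ k j); rewrite !mxE !big_ord1 !mxE !eqxx mulr1 => ->.
  by rewrite andbT mulr_natl.
exists (A ord0 ord0); apply/matrixP=> k i; rewrite !mxE.
have [-> | nz_i] := eqVneq i ord0; last by rewrite (uE _ _ _ nz_i).
(* Column 0 is compared with a second index, which exists in degree at least 2. *)
by rewrite (uE k _ (lift ord0 ord0)) // (uE _ _ ord0) ?eqxx.
Qed.

(** Rewrites the centre in the form used by the induction, which alternates between [SL] and
    [GL]. *)
Lemma center_SL n :
  'Z(SL n.+2 F) = 'Z('GL_n.+2[F]) :&: SL n.+2 F.
Proof.
apply/setP=> u; apply/setIP/setIP=> [[Su /cent_SL_scalar[a ua]] | [/centerP[_ cu] Su]].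
  by split=> //; apply: scalar_GL_center ua.
by split=> //; apply/centP=> v _; apply: cu; rewrite inE.
Qed.

Lemma SL_der1 n : ('GL_n.+1[F])^`(1) \subset SL n.+1 F.
Proof.
rewrite derg1 gen_subG; apply/subsetP=> _ /imset2P[u v _ _ ->].
have duv := GL_det (v * u).
rewrite inE; apply/eqP/(mulfI duv).
by rewrite -det_mulmx -GL_MxE -commgC mulr1 !GL_MxE !det_mulmx mulrC.
Qed.

(** Go through the product of the scalars with [SL]: up to it by the hypothesis, and from it to [GL]
    by an abelian quotient, since it contains the derived subgroup. *)
Lemma center_SL_ogs_over_GL n :
  ogs_over ('Z('GL_n.+1[F]) :&: SL n.+1 F) (SL n.+1 F) ->
  ogs_over 'Z('GL_n.+1[F]) 'GL_n.+1[F].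
Proof.
move=> ogsSL; pose W := ('Z('GL_n.+1[F]))%G.
have nWS : SL n.+1 F \subset 'N(W).
  by rewrite (subset_trans _ (normal_norm (center_normal _))) ?subsetT.
have sSW : SL n.+1 F \subset W <*> SL n.+1 F by apply: joing_subr.
apply: (@ogs_over_trans _ _ (W <*> SL n.+1 F)); first exact: subsetT.
  by rewrite norm_joinEr //; apply: ogs_over_mul.
have sder := subset_trans (SL_der1 n) sSW.
apply: abelian_ogs_over; first exact: sub_der1_normal sder (subsetT _).
exact: sub_der1_abelian.
Qed.

(** * The stabiliser of a line and its action on the quotient space *)

Section LineStabilizer.

Variable n : nat.
Local Notation GL2 := {'GL_n.+2[F]}.
Local Notation e0 := (delta_mx ord0 ord0 : 'rV[F]_n.+2).
Local Notation ur u := (@ursubmx F 1 n.+1 1 n.+1 (GLval u)).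
Local Notation dr u := (@drsubmx F 1 n.+1 1 n.+1 (GLval u)).
Local Notation ul u := (@ulsubmx F 1 n.+1 1 n.+1 (GLval u)).
Local Notation dl u := (@dlsubmx F 1 n.+1 1 n.+1 (GLval u)).

(** Matrices act on row vectors from the right, so the line of [e0] is stable exactly when the first
    row vanishes beyond its first entry. *)
Definition line_stab : {set GL2} := [set u : GL2 | ur u == 0%R].

Lemma line_stabP (u : GL2) :
  reflect (exists c, e0 *m GLval u = c *: e0)%R (u \in line_stab).
Proof.
rewrite inE -rowE; apply: (iffP eqP) => [u0 | [c uc]].
  exists (GLval u ord0 ord0); apply/rowP=> j; rewrite !mxE eqxx /=.
  have [-> | nz_j] := eqVneq j ord0; first by rewrite mulr1.
  case: (unliftP ord0 j) => [k jk | j0]; last by rewrite j0 eqxx in nz_j.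
  move/matrixP/(_ ord0 k): u0; rewrite !mxE mulr0 => <-; congr (GLval u _ _).
    exact: val_inj.
  by rewrite jk; apply: val_inj.
apply/matrixP=> i j; rewrite !mxE.
move/rowP/(_ (rshift 1 j)): uc; rewrite !mxE /= mulr0 => <-.
by congr (GLval u _ _); apply: val_inj; rewrite /= ord1.
Qed.

Lemma line_stab_block (u : GL2) : u \in line_stab ->
  GLval u = block_mx (ul u) 0%R (dl u) (dr u).
Proof. by rewrite inE => /eqP <-; rewrite submxK. Qed.

Lemma line_stab_mul (u v : GL2) : u \in line_stab -> v \in line_stab ->
  GLval (u * v) = block_mx (ul u *m ul v)%R 0%R
                    (dl u *m ul v + dr u *m dl v)%R (dr u *m dr v)%R.
Proof.
move=> /line_stab_block uE /line_stab_block vE.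
have := mulmx_block (ul u) 0%R (dl u) (dr u) (ul v) 0%R (dl v) (dr v).
by rewrite -uE -vE !mulmx0 !mul0mx !addr0 add0r.
Qed.

Lemma line_stab_group_set : group_set line_stab.
Proof.
apply/group_setP; split=> [|u v Hu Hv].
  by apply/line_stabP; exists 1%R; rewrite mulmx1 scale1r.
by rewrite inE line_stab_mul // block_mxKur.
Qed.
Canonical line_stab_group := Group line_stab_group_set.

Lemma det_line_stab (u : GL2) : u \in line_stab ->
  (\det (GLval u) = \det (ul u) * \det (dr u))%R.
Proof. by move=> /line_stab_block uE; rewrite -(det_lblock _ (dl u)) -uE. Qed.

Lemma dr_unit (u : GL2) : u \in line_stab -> dr u \in unitmx.
Proof.
move=> Hu; rewrite unitmxE unitfE; have := GL_det u.
by rewrite det_line_stab // mulf_eq0 negb_or => /andP[].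
Qed.

(* For [u] stabilising the line of [e0]: its action on the quotient by this line. *)
Definition line_quotient (u : GL2) : {'GL_n.+1[F]} :=
  odflt 1 (insub (dr u) : option {'GL_n.+1[F]}).

Lemma line_quotientE u : u \in line_stab -> GLval (line_quotient u) = dr u.
Proof.
by move/dr_unit=> Hu; rewrite /line_quotient; case: insubP => //= /negP[].
Qed.

Lemma line_quotientM : {in line_stab &, {morph line_quotient : u v / u * v}}.
Proof.
move=> u v Hu Hv; apply: GLval_inj.
by rewrite GL_MxE !line_quotientE ?groupM // line_stab_mul // block_mxKdr.
Qed.
Canonical line_quotient_morphism := Morphism line_quotientM.

End LineStabilizer.

End LinearGroups.

(** * Induction on the degree for [SL], and [PSL] *)

Section SpecialLinear.

Import GRing.Theory.

Variable F : finFieldType.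

Lemma gcd_card_points n : gcdn #|F|.-1 (\sum_(i < n.+1) #|F| ^ i) <= n.+1.
Proof.
(* Each [#|F| ^ i] is 1 modulo [#|F| - 1]. *)
set d := gcdn _ _; apply: dvdn_leq => //.
have dq i : d %| (#|F| ^ i).-1 by rewrite predn_exp dvdn_mulr ?dvdn_gcdl.
have : d %| \sum_(i < n.+1) #|F| ^ i by apply: dvdn_gcdr.
rewrite (eq_bigr (fun i : 'I_n.+1 => (#|F| ^ i).-1 + 1)%N) => [|i _].
  by rewrite big_split /= sum1_card card_ord dvdn_addr // dvdn_sum.
by rewrite addn1 prednK // expn_gt0 (ltnW (finNzRing_gt1 F)).
Qed.

Section Step.

Variable n : nat.
Local Notation e0 := (delta_mx ord0 ord0 : 'rV[F]_n.+2).
Local Notation H := (@line_stab_group F n).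
Local Notation S := (SL n.+2 F).

Lemma line_stab_ogs_over_SL : ogs_over (S :&: H) S.
Proof.
have [g [g_basis g_trans g_line]] := exists_singer_cycle F n.+1.
(* [diag(1, ..., 1, 1 / det g) * g] has determinant 1 and agrees with [g] on the
   first [n.+1] basis vectors. *)
pose c := ((\det (GLval g))^-1)%R.
pose T : 'M[F]_n.+2 := diag_mx (\row_i if i == ord_max then c else 1)%R.
have detT : (\det T = c)%R.
  rewrite det_diag (bigD1 ord_max) //= big1 ?mxE ?eqxx ?mulr1 // => i ni.
  by rewrite mxE (negPf ni).
have [t tE] : exists t : {'GL_n.+2[F]}, GLval t = T.
  by apply: unitmx_GL; rewrite unitmxE detT unitfE invr_eq0 GL_det.
have T_fix (i : 'I_n.+2) : i != ord_max ->
  (delta_mx ord0 i *m T = delta_mx ord0 i :> 'rV_n.+2)%R.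
  move=> ni; rewrite -rowE; apply/rowP=> j; rewrite !mxE (negPf ni) eqxx /=.
  by rewrite eq_sym; case: eqP.
have q1 := finNzRing_gt1 F.
(* The exponent [#|F|.-1] brings the determinant of [g] to 1, and the sum counts the lines, which
   [g] permutes cyclically. *)
apply: (@ogs_over_cyclic_cover _ (SL_group n.+2 F) H g (t * g) #|F|.-1
          (\sum_(i < n.+2) #|F| ^ i)).
- by rewrite -ltnS prednK // ltnW.
- by rewrite big_ord_recl expn0.
- by move=> k; apply/line_stabP/idP; [apply: (g_line k).1 | apply: (g_line k).2].
- apply/subsetP=> u _.
  have [|k uk] := g_trans (e0 *m GLval u)%R.
    apply/eqP=> u0; have := mulmxK (GL_unitmx u) e0.
    rewrite u0 mul0mx => /rowP/(_ ord0)/esym/eqP.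
    by rewrite !mxE eqxx oner_eq0.
  suff Huk : u * g ^- k \in H.
    by have := mem_mulg Huk (mem_cycle g k); rewrite mulgKV.
  apply/line_stabP; exists 1%R.
  by rewrite GL_MxE mulmxA uk GL_VxE mulmxK ?GL_unitmx // scale1r.
- rewrite inE det_GLX; apply/eqP/(mulfI (GL_det g)).
  by rewrite mulr1 -exprS (prednK (ltnW q1)) expf_card.
- by rewrite inE GL_MxE tE det_mulmx detT mulVf ?GL_det.
(* Since [i] is at most [n.+1], the first [i] steps of the orbit of [e0] start from basis vectors
   other than the last, where [t * g] and [g] agree. *)
move=> i ltid; have {ltid} lein : i <= n.+1.
  by rewrite -ltnS; apply: leq_trans ltid (gcd_card_points _).
suff tgi : (e0 *m GLval ((t * g) ^+ i)%g = e0 *m GLval (g ^+ i)%g)%R.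
  apply/line_stabP; exists 1%R.
  by rewrite GL_MxE mulmxA tgi GL_VxE mulmxK ?GL_unitmx // scale1r.
elim: i lein => [|i IHi] lein; first by rewrite !expg0.
rewrite !expgSr GL_MxE mulmxA IHi 1?ltnW // GL_MxE g_basis 1?ltnW //.
rewrite mulmxA tE T_fix ?GL_MxE ?mulmxA ?g_basis 1?ltnW //.
by rewrite -val_eqE /= inordK ?ltn_eqF // ltnS ltnW.
Qed.

(** Any invertible matrix is the lower block of a matrix of determinant 1 whose corner is the
    inverse determinant. *)
Lemma line_quotient_onto :
  line_quotient_morphism F n @* (S :&: H) = 'GL_n.+1[F].
Proof.
apply/eqP; rewrite eqEsubset subsetT; apply/subsetP=> v _.
pose A : 'M[F]_(1 + n.+1) :=
  block_mx ((\det (GLval v))^-1)%:M%R 0%R 0%R (GLval v).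
have detA : (\det A = 1)%R.
  by rewrite det_lblock det_scalar1 mulVf ?GL_det.
have [u uA] : exists u : {'GL_n.+2[F]}, GLval u = A.
  by apply: unitmx_GL; rewrite unitmxE detA unitr1.
have Hu : u \in H by rewrite inE uA block_mxKur.
apply/morphimP; exists u => //; first by rewrite 2!inE uA detA eqxx Hu.
by apply: GLval_inj; rewrite /= line_quotientE // uA block_mxKdr.
Qed.

(** In the kernel the lower diagonal block is the identity, hence by determinant 1 so is the corner;
    multiplication then adds the lower left blocks. *)
Lemma abelian_line_quotient_ker :
  abelian ('ker_(S :&: H) (line_quotient_morphism F n)).
Proof.
have blk w : w \in 'ker_(S :&: H) (line_quotient_morphism F n) ->
  [/\ w \in H, @ulsubmx F 1 n.+1 1 n.+1 (GLval w) = 1%:M%R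
     & @drsubmx F 1 n.+1 1 n.+1 (GLval w) = 1%:M%R].
  case/setIP=> /setIP[Sw Hw] /mker/(congr1 (@GLval _ _)).
  rewrite /= line_quotientE // => dw; split=> //.
  move: Sw; rewrite inE det_line_stab // dw det1 mulr1 det_mx11 => /eqP w1.
  by rewrite [LHS]mx11_scalar w1.
apply/centsP=> u /blk[Hu ulu dru] v /blk[Hv ulv drv].
apply: GLval_inj; rewrite !line_stab_mul // ulu ulv dru drv !mul1mx !mulmx1.
by rewrite addrC.
Qed.

Lemma center_SL_sub_line_stab :
  'Z('GL_n.+2[F]) :&: S \subset S :&: H.
Proof.
apply/subsetP=> u /setIP[Zu Su]; rewrite inE Su /=.
have [|a ua] := cent_SL_scalar (u := u); last first.
  by apply/line_stabP; exists a; rewrite ua mul_mx_scalar.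
by case/centerP: Zu => _ cu; apply/centP=> v _; apply: cu; rewrite inE.
Qed.

Lemma line_quotient_center u : 
  u \in 'Z('GL_n.+2[F]) -> line_quotient u \in 'Z('GL_n.+1[F]).
Proof.
case/centerP=> _ cu.
have [|a ua] := cent_SL_scalar (u := u).
  by apply/centP=> v _; apply: cu; rewrite inE.
have Hu : u \in H by apply/line_stabP; exists a; rewrite ua mul_mx_scalar.
apply: (@scalar_GL_center _ _ _ a); rewrite line_quotientE // ua.
by apply/matrixP=> i j; rewrite !mxE.
Qed.

(** Climb [Z <= Z U <= P <= S], with [P] the line stabiliser in [S] and [U] the kernel of [f] on
    [P]. The first step has abelian quotient, the last is the cyclic cover, and the middle one is
    transported by [f] to [GL] in degree one less. *)
Lemma center_ogs_over_SL_step :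
  ogs_over ('Z('GL_n.+1[F]) :&: SL n.+1 F) (SL n.+1 F) ->
  ogs_over ('Z('GL_n.+2[F]) :&: S) S.
Proof.
move=> ogsSL.
pose f := line_quotient_morphism F n.
pose P := (SL_group n.+2 F :&: H)%G.
pose Z := ('Z('GL_n.+2[F]) :&: S)%G.
pose U := ('ker_P f)%G.
have abU : abelian U := abelian_line_quotient_ker.
have sZP : Z \subset P := center_SL_sub_line_stab.
have sUP : U \subset P := subsetIl _ _.
have nZU : U \subset 'N(Z).
  apply: cents_norm; rewrite centsC (subset_trans (subsetIl _ _)) //.
  exact: subset_trans (subsetIr _ _) (centS (subsetT U)).
apply: (@ogs_over_trans _ _ P); [exact: subsetIl | | exact: line_stab_ogs_over_SL].
apply: (@ogs_over_trans _ _ (Z <*> U)); first by rewrite join_subG sZP.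
  rewrite norm_joinEr //; apply: ogs_over_mul => //.
  apply: abelian_ogs_over; last exact: quotient_abelian.
  by rewrite -sub_abelian_normal ?subsetIr.
have sPH : P \subset H := subsetIr _ _.
apply: (ogs_over_morphim (f := f) _ sPH _).2.
- by rewrite join_subG sZP.
- exact: joing_subr.
rewrite line_quotient_onto.
have sfW : f @* (Z <*> U) \subset 'Z('GL_n.+1[F]).
  rewrite sub_morphim_pre ?(subset_trans _ sPH) ?join_subG ?sZP //.
  apply/andP; split; apply/subsetP=> u.
    move=> Zu; apply/morphpreP; split.
      exact: (subsetP sPH _ (subsetP sZP _ Zu)).
    by case/setIP: Zu => /line_quotient_center.
  by case/setIP=> _; apply: subsetP; apply: ker_sub_pre.
(* The image of [Z U] consists of central elements, so an abelian step leads from it to the centre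
   of [GL], where the induction hypothesis takes over. *)
apply: ogs_over_trans (center_SL_ogs_over_GL ogsSL); first exact: subsetT.
apply: abelian_ogs_over; last exact: quotient_abelian (center_abelian _).
by rewrite -sub_abelian_normal ?center_abelian.
Qed.

End Step.

Lemma center_ogs_over_SL n :
  ogs_over ('Z('GL_n.+1[F]) :&: SL n.+1 F) (SL n.+1 F).
Proof.
elim: n => [|n IHn]; last exact: center_ogs_over_SL_step.
rewrite (_ : SL 1 F = 1) ?(setIidPr (sub1G _)).
  exact: cyclic_ogs_over (cyclic1 _).
apply/trivgP/subsetP=> u; rewrite !inE => /eqP detu; apply/eqP/GLval_inj.
by rewrite GL_1E [LHS]mx11_scalar -det_mx11 detu.
Qed.

Lemma PSL_ogs n : 2 <= n -> ogs_over 1 (PSL n F).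
Proof.
case: n => [|[|n]] // _; apply: (ogs_over_quotient (center_normal _)).1.
by rewrite /= center_SL; apply: center_ogs_over_SL.
Qed.

End SpecialLinear.


Theorem theorem1 (gT : finGroupType) (G : {group gT})
    (hG : forall K : section gT, composition_factor G K ->
       [\/ cyclic K,
           exists n : nat, K \isog 'Alt_('I_n)
         | exists (n : nat) (F : finFieldType), 2 <= n /\ K \isog PSL n F]) :
  has_ordered_generating_system G.
Proof.
apply: ogs_over_has_ogs; have [s compG] := exists_comps G.
apply: (comps_ogs_over compG) => K sK.
have [cycK | [n isoK] | [n [F [n2 isoK]]]] := hG K (ex_intro2 _ _ s compG sK).
- exact: cyclic_ogs_over.
- exact: ogs_over_isog isoK (Alt_ogs _).
- exact: ogs_over_isog isoK (PSL_ogs F n2).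
Qed.
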